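(* For every integer $c\geq 1$ there is a planar graph $G$ such that for every tree $T$ and every graph $H$ with $\operatorname{tw}(H)\leq 2$, the graph $G$ is not contained in $H\boxtimes T\boxtimes K_c$.
   Context: All graphs are finite, simple and undirected. The strong product $A\boxtimes B$ of graphs $A$ and $B$ has vertex set $V(A)\times V(B)$, where distinct vertices $(v,x),(w,y)$ are adjacent if ($v=w$ and $xy\in E(B)$) or ($x=y$ and $vw\in E(A)$) or ($vw\in E(A)$ and $xy\in E(B)$). A graph $H$ is contained in a graph $G$ if $H$ is isomorphic to a subgraph of $G$. $K_c$ is the complete graph on $c$ vertices. $\operatorname{tw}$ denotes treewidth. *)

(* Defs.v *)
From Stdlib Require Import Reals.
From mathcomp Require Import all_boot.
Set Implicit Arguments. Unset Strict Implicit. Unset Printing Implicit Defensive.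

Record sgraph := SGraph {
  vertex :> finType;
  sadj : rel vertex;
  sadj_sym : symmetric sadj;
  sadj_irr : irreflexive sadj }.
Arguments sadj : clear implicits.

Definition strong_rel (A B : finType) (eA : rel A) (eB : rel B) : rel (A * B) :=
  fun x y => (x != y) &&
    [|| (x.1 == y.1) && eB x.2 y.2,
        (x.2 == y.2) && eA x.1 y.1
      | eA x.1 y.1 && eB x.2 y.2].

Lemma strong_rel_sym (G H : sgraph) : symmetric (@strong_rel (vertex G) (vertex H) (sadj G) (sadj H)).
Proof.
move=> [a b] [c d]; rewrite /strong_rel /= eq_sym.
by rewrite (eq_sym a) (eq_sym b) (@sadj_sym G a) (@sadj_sym H b).
Qed.

Lemma strong_rel_irr (G H : sgraph) : irreflexive (@strong_rel (vertex G) (vertex H) (sadj G) (sadj H)).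
Proof. by move=> x; rewrite /strong_rel eqxx. Qed.

Definition strong (G H : sgraph) : sgraph :=
  SGraph (@strong_rel_sym G H) (@strong_rel_irr G H).

Definition complete_rel (c : nat) : rel 'I_c := fun i j => i != j.
Arguments complete_rel : clear implicits.
Lemma complete_sym c : symmetric (@complete_rel c).
Proof. by move=> i j; rewrite /complete_rel eq_sym. Qed.
Lemma complete_irr c : irreflexive (@complete_rel c).
Proof. by move=> i; rewrite /complete_rel eqxx. Qed.
Definition K (c : nat) : sgraph := SGraph (@complete_sym c) (@complete_irr c).

Definition contained (G H : sgraph) : Prop :=
  exists f : G -> H, injective f /\ forall x y : G, sadj G x y -> sadj H (f x) (f y).

Definition connected (G : sgraph) : Prop := forall x y : G, connect (sadj G) x y.

Definition has_cycle (G : sgraph) : Prop :=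
  exists s : seq G, [/\ 3 <= size s, uniq s & cycle (sadj G) s].

Definition is_tree (T : sgraph) : Prop :=
  [/\ 0 < #|T|, connected T & ~ has_cycle T].

Definition tree_decomposition (H T : sgraph) (B : T -> {set H}) : Prop :=
  [/\ is_tree T,
      (forall v : H, exists t : T, v \in B t),
      (forall u v : H, sadj H u v -> exists t : T, (u \in B t) && (v \in B t)) &
      (forall (v : H) (t1 t2 : T), v \in B t1 -> v \in B t2 ->
          connect [rel a b | [&& sadj T a b, v \in B a & v \in B b]] t1 t2)].

Definition tw_le (H : sgraph) (k : nat) : Prop :=
  exists (T : sgraph) (B : T -> {set H}),
    tree_decomposition B /\ forall t : T, #|B t| <= k.+1.

Local Open Scope R_scope.
Definition arc_cont (g : R -> R * R) : Prop :=
  continuity (fun t => fst (g t)) /\ continuity (fun t => snd (g t)).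

(* p : positions of vertices (distinct points); g u v : arc for the edge uv,
   parametrised by [0,1] (continuous on R, only its restriction to [0,1] matters),
   injective on [0,1], from p u to p v, whose interior avoids all vertices and
   the arcs of all other edges. *)
Definition plane_embedding (G : sgraph) (p : G -> R * R) (g : G -> G -> R -> R * R) : Prop :=
  injective p /\
  forall u v : G, sadj G u v ->
    [/\ arc_cont (g u v),
        g u v 0 = p u /\ g u v 1 = p v,
        (forall s t, 0 <= s <= 1 -> 0 <= t <= 1 -> g u v s = g u v t -> s = t),
        (forall t (w : G), 0 < t < 1 -> g u v t <> p w) &
        (forall (u' v' : G), sadj G u' v' ->
            ~ ((u = u' /\ v = v') \/ (u = v' /\ v = u')) ->
            forall s t, 0 < s < 1 -> 0 < t < 1 -> g u v s <> g u' v' t)].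

Definition planar (G : sgraph) : Prop := exists p g, @plane_embedding G p g.

(* Main.v *)
(* An embedding of [G] in [strong (strong H T) (K c)] is a pair of maps
   [phi : G -> H] and [psi : G -> T] sending edges to edges or points, whose
   common fibres have at most [c] elements. The only facts needed about the
   targets are that [T] is triangle-free and [H] is K4-free.

   Let [uv] be an edge with a long path [P] in its common neighbourhood.
   (1) If [psi u <> psi v] then [P] lies in two fibres of [psi], since [T] has no
   triangle, so [phi] has small fibres on [P]. If moreover [phi u <> phi v], some
   edge of [P] avoids the colours of [u] and [v] and is not contracted by [phi],
   which gives a K4 in [H]. So [phi u = phi v].
   (2) If the edges joining [u] and [v] to [P] also have such paths, then
   [phi u = phi v] in any case: otherwise [psi u = psi v], and a vertex [x] of [P]
   with [psi x <> psi u] has [phi u = phi x = phi v] by (1); hence [P] lies in a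
   single fibre of [psi] and again [H] contains a K4.
   (3) One level deeper, [phi] is constant on [u], [v], [P] by (2), so [P] cannot
   lie in two fibres of [psi] and [psi u = psi v].
   (4) Yet one level deeper, [P] lies in a common fibre, a contradiction.

   Iterated stacking in the faces of a triangle gives a planar graph in which
   edges have paths of this kind to any prescribed depth. *)
From Stdlib Require Import Reals Lra.
Require Import Defs.
From mathcomp Require Import all_boot zify.

Set Implicit Arguments. Unset Strict Implicit. Unset Printing Implicit Defensive.

(** * Cliques and tree-decompositions *)

Definition restr (G : sgraph) (X : {set G}) : rel G :=
  fun a b => [&& sadj G a b, a \in X & b \in X].

Definition conn_in (G : sgraph) (X : {set G}) : Prop :=
  {in X &, forall a b, connect (restr X) a b}.

(** If every vertex of [A] had two neighbours in [A], a path could be prolonged forever or would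
    close a cycle. *)
Lemma acyclic_leaf (G : sgraph) (A : {set G}) :
  ~ has_cycle G -> A != set0 ->
  exists2 l, l \in A &
    {in A &, forall x y, sadj G l x -> sadj G l y -> x = y}.
Proof.
move=> acyc /set0Pn[a Aa].
case: (boolP [exists l in A, [forall x in A, forall y in A,
    sadj G l x ==> sadj G l y ==> (x == y)]]) => [/exists_inP[l Al lP]|noleaf].
  exists l => // x y Ax Ay lx ly; apply/eqP.
  by move/forall_inP/(_ x Ax)/forall_inP/(_ y Ay): lP; rewrite lx ly.
have two l : l \in A -> forall y, exists z, [/\ z \in A, sadj G l z & z != y].
  move=> Al y; move: noleaf; rewrite negb_exists_in => /forall_inP/(_ l Al).
  rewrite negb_forall_in => /exists_inP[x Ax].
  rewrite negb_forall_in => /exists_inP[x' Ax'].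
  rewrite !negb_imply => /and3P[lx lx' xx'].
  have [xy|xy] := eqVneq x y; last by exists x.
  by exists x'; split=> //; rewrite -xy eq_sym.
have long n : exists x p,
    [/\ size p = n, all (mem A) (x :: p), uniq (x :: p) & path (sadj G) x p].
  elim: n => [|n [x [p [<- Axp Uxp Pxp]]]]; first by exists a, [::]; rewrite /= Aa.
  have /andP[Ax _] := Axp.
  (* Avoiding the second vertex of the path gives a cycle closed at [z] at least three vertices. *)
  have [z [Az xz zp]] := two x Ax (head x p).
  have [zin|zout] := boolP (z \in x :: p); last first.
    exists z, (x :: p); split=> //; first by rewrite /= Az.
      by rewrite cons_uniq zout.
    by rewrite /= sadj_sym xz.
  case: acyc.
  have zx : z != x by apply: contraL xz => /eqP->; rewrite sadj_irr.
  move: zin; rewrite inE (negPf zx) /= => zin.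
  case/splitPr: zin zp Uxp Pxp {Axp} => [p1 p2] zp Uxp Pxp.
  exists (x :: rcons p1 z); split.
  - by case: p1 zp {Uxp Pxp} => [|y p1] /=; rewrite ?eqxx // size_rcons.
  - by move: Uxp; rewrite -cat_rcons -cat_cons cat_uniq => /andP[].
  - move: Pxp; rewrite -cat_rcons cat_path => /andP[Pxp _].
    by rewrite /= rcons_path Pxp last_rcons sadj_sym xz.
have [x [p [sp _ Uxp _]]] := long #|G|.
by have := max_card (mem (x :: p)); rewrite (card_uniqP Uxp) /= sp ltnn.
Qed.

(** A simple path through [l] would enter and leave it by the same vertex. *)
Lemma conn_in_leaf (G : sgraph) (X : {set G}) (l : G) :
  {in X &, forall x y, sadj G l x -> sadj G l y -> x = y} ->
  conn_in X -> conn_in (X :\ l).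
Proof.
move=> leaf cX a b; rewrite !inE => /andP[al Xa] /andP[bl Xb].
have /connectP[p0 Pp0 b_p0] := cX a b Xa Xb; subst b.
case/shortenP: Pp0 bl Xb => p Pp Up _ bl _.
have lp : l \notin p.
  apply/negP => /splitPr sp; case: sp Pp Up bl => p1 [|y p2].
    by rewrite last_cat /= eqxx.
  move=> Pp Up _; move: Pp; rewrite cat_path /=.
  move=> /and4P[_ /and3P[x_l Xx Xl] /and3P[l_y _ Xy] _].
  have xy : last a p1 = y by apply: leaf; rewrite // sadj_sym.
  move: Up; rewrite -cat_cons cat_uniq => /and3P[_ /hasPn/(_ y) y_out _].
  have y_in : y \in a :: p1 by rewrite -xy mem_last.
  by apply: (negP (y_out _)) y_in; rewrite !inE eqxx orbT.
apply/connectP; exists p => //.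
elim: p a al Xa {Up bl cX} Pp lp => //= y p IH a al Xa /andP[/and3P[ay _ Xy] Pp].
rewrite inE negb_or => /andP[ly lp].
by rewrite /restr ay !inE al Xa eq_sym ly Xy /=; apply: IH; rewrite // eq_sym.
Qed.

Lemma conn_in_neighbour (G : sgraph) (X : {set G}) (l x : G) :
  conn_in X -> l \in X -> x \in X -> x != l -> exists2 n, n \in X & sadj G l n.
Proof.
move=> cX Xl Xx xl; have /connectP[[|n p] /=] := cX l x Xl Xx.
  by move=> _ xl'; rewrite xl' eqxx in xl.
by case/andP=> /and3P[ln _ Xn] _ _; exists n.
Qed.

(* By deleting leaves of the ambient set [A]
   until some leaf lies in all the members of the family. *)
Lemma subtree_helly (G : sgraph) (I : finType) (C : {set I})
    (S : I -> {set G}) (A : {set G}) :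
  ~ has_cycle G -> A != set0 ->
  {in C, forall i, conn_in (A :&: S i)} ->
  {in C &, forall i j, exists t, t \in A :&: S i :&: S j} ->
  exists t, {in C, forall i, t \in S i}.
Proof.
move=> acyc; have [n] := ubnP #|A|; elim: n A => // n IH A leAn A0 cA mA.
have [l Al leaf] := acyclic_leaf acyc A0.
have [/forall_inP all_l|] := boolP [forall i in C, l \in S i].
  by exists l.
rewrite negb_forall_in => /exists_inP[k Ck lk].
(* A set through [l] meets [S k] away from [l], so by connectivity it contains the only neighbour of
   [l] in [A]. *)
have nb i : i \in C -> l \in S i -> exists2 n, n \in A :&: S i & sadj G l n.
  move=> Ci li; have [x] := mA i k Ci Ck; rewrite inE => /andP[Aix kx].
  apply: (conn_in_neighbour (cA i Ci) _ Aix); first by rewrite inE Al.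
  by apply: contraNneq lk => <-.
have mA' : {in C &, forall i j, exists t, t \in (A :\ l) :&: S i :&: S j}.
  move=> i j Ci Cj; have [t] := mA i j Ci Cj.
  rewrite !inE => /andP[/andP[At it] jt].
  have [tl|tl] := eqVneq t l; last by exists t; rewrite !inE tl At it jt.
  subst t; have [x] := nb i Ci it; rewrite inE => /andP[Ax ix] lx.
  have [y] := nb j Cj jt; rewrite inE => /andP[Ay jy] ly.
  have xy := leaf x y Ax Ay lx ly; subst y; exists x; rewrite !inE Ax ix jy !andbT.
  by apply: contraTneq lx => ->; rewrite sadj_irr.
apply: (IH (A :\ l)) => //.
- by move: leAn; rewrite (cardsD1 l) Al.
- by apply/set0Pn; have [t] := mA' k k Ck Ck; rewrite !inE -!andbA => /and3P[? ? _];
    exists t; rewrite !inE; apply/andP.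
- move=> i Ci; rewrite setIDAC; apply: conn_in_leaf (cA i Ci).
  by move=> x y; rewrite !inE => /andP[Ax _] /andP[Ay _]; apply: leaf.
Qed.

(** The subtrees of the vertices of [C] meet pairwise, so by the Helly property one bag contains
    [C]. *)
Lemma clique_tw_le (H : sgraph) (k : nat) (C : {set H}) :
  tw_le H k -> {in C &, forall a b, a != b -> sadj H a b} -> #|C| <= k.+1.
Proof.
move=> [T [B [[[T0 _ acyc] Bv Be Bc] Bk]]] cl.
have [t tC] : exists t, {in C, forall a, t \in [set t | a \in B t]}.
  apply: (@subtree_helly T H C _ setT) => //.
  - by rewrite -card_gt0 cardsT.
  - move=> a Ca t1 t2; rewrite !setTI !inE => a1 a2.
    rewrite (@eq_connect _ _ [rel x y | [&& sadj T x y, a \in B x & a \in B y]]).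
      exact: Bc.
    by move=> x y; rewrite /restr !inE.
  - move=> a b Ca Cb; have [<-|ab] := eqVneq a b.
      by have [t ta] := Bv a; exists t; rewrite !inE ta.
    by have [t /andP[ta tb]] := Be _ _ (cl a b Ca Cb ab); exists t; rewrite !inE ta.
apply: leq_trans (Bk t); apply/subset_leq_card/subsetP => a /tC.
by rewrite inE.
Qed.

Lemma tw2_no_K4 (H : sgraph) (a b d e : H) :
  tw_le H 2 -> uniq [:: a; b; d; e] ->
  pairwise (sadj H) [:: a; b; d; e] -> False.
Proof.
move=> twH U P; have := @clique_tw_le H 2 [set x in [:: a; b; d; e]] twH.
rewrite cardsE (card_uniqP U) => /(_ _)/negP; apply=> //.
move: P; rewrite /= !andbT => /and3P[/and3P[ab ad ae] /andP[bd be] de] x y.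
by rewrite !inE => /or4P[]/eqP-> /or4P[]/eqP->; rewrite ?eqxx // sadj_sym.
Qed.

Lemma tree_triangle_free (T : sgraph) (a b c : T) :
  is_tree T -> sadj T a b -> sadj T b c -> sadj T c a -> False.
Proof.
move=> [_ _ acyc] ab bc ca; apply: acyc; exists [:: a; b; c]; split=> //=.
  have neq x y : sadj T x y -> x != y.
    by apply: contraTneq => ->; rewrite sadj_irr.
  by rewrite !inE negb_or (neq _ _ ab) (neq _ _ bc) eq_sym (neq _ _ ca).
by rewrite ab bc ca.
Qed.

(** * Edges with long paths in their common neighbourhood *)

(** The conjunct [rich N k' u v] makes richness pass to smaller depths. *)
Fixpoint rich (G : sgraph) (N k : nat) (u v : G) : Prop :=
  if k is k'.+1 then
    rich N k' u v /\
    exists p : nat -> G,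
      [/\ {in gtn N &, injective p},
          (forall m, m < N -> rich N k' u (p m) /\ rich N k' v (p m)) &
          (forall m, m.+1 < N -> rich N k' (p m) (p m.+1))]
  else sadj G u v.

Lemma richS (G : sgraph) N k (u v : G) : rich N k.+1 u v ->
  rich N k u v /\
  exists p : nat -> G,
    [/\ {in gtn N &, injective p},
        (forall m, m < N -> rich N k u (p m) /\ rich N k v (p m)) &
        (forall m, m.+1 < N -> rich N k (p m) (p m.+1))].
Proof. by []. Qed.

Lemma rich_adj (G : sgraph) N k (u v : G) : rich N k u v -> sadj G u v.
Proof. by elim: k => // k IH [/IH]. Qed.

(* Cut [0, N) into [2d+1] blocks of [d+1] consecutive integers: some block
   avoids the colours [a] and [b], and it is not monochromatic. *)
Lemma sparse_colours (I : eqType) (col : nat -> I) (d N : nat) (a b : I) :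
  N = (d.*2.+1 * d.+1)%N ->
  (forall x, #|[set m : 'I_N | col m == x]| <= d) ->
  exists m, [/\ m.+1 < N, col m != col m.+1 &
    [/\ col m != a, col m != b, col m.+1 != a & col m.+1 != b]].
Proof.
move=> defN few.
have lt_block (j : 'I_d.*2.+1) r : r < d.+1 -> j * d.+1 + r < N.
  by move=> lt_r; have lt_j := ltn_ord j; rewrite defN; nia.
have [j jP] : exists j : 'I_d.*2.+1, forall r, r < d.+1 ->
    col (j * d.+1 + r) != a /\ col (j * d.+1 + r) != b.
  case: (boolP [exists j : 'I_d.*2.+1, [forall r : 'I_d.+1,
      (col (j * d.+1 + r) != a) && (col (j * d.+1 + r) != b)]]) => [|none].
    case/existsP=> j /forallP jP; exists j => r lt_r.
    by apply/andP; apply: (jP (Ordinal lt_r)).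
  (* Hitting every block takes [2d+1] positions coloured [a] or [b], but at most [2d] exist. *)
  have hit (j : 'I_d.*2.+1) : exists m : 'I_N, (m %/ d.+1 == j :> nat) &&
      ((col m == a) || (col m == b)).
    move: none; rewrite negb_exists => /forallP/(_ j); rewrite negb_forall.
    case/existsP=> r hit; exists (Ordinal (lt_block j r (ltn_ord r))) => /=.
    by rewrite divnMDl // divn_small // addn0 eqxx; move: hit; rewrite negb_and !negbK.
  have [h hP] := fin_all_exists hit.
  have h_inj : injective h.
    move=> j j' eqh; apply: val_inj => /=.
    by have /andP[/eqP<- _] := hP j; have /andP[/eqP<- _] := hP j'; rewrite eqh.
  have sub : h @: setT \subset [set m : 'I_N | col m == a] :|: [set m : 'I_N | col m == b].
    by apply/subsetP => _ /imsetP[j _ ->]; rewrite !inE; have /andP[] := hP j.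
  have := leq_trans (leq_card_setU _ _) (leq_add (few a) (few b)).
  move/(leq_trans (subset_leq_card sub)).
  by rewrite card_imset // cardsT card_ord addnn ltnn.
case: (boolP [exists r : 'I_d, col (j * d.+1 + r) != col (j * d.+1 + r).+1]).
  case/existsP=> r ne; have lt_r := ltn_ord r.
  exists (j * d.+1 + r); split=> //.
    by rewrite -addnS; apply: lt_block.
  by rewrite -addnS; have [? ?] := jP r (ltnW lt_r); have [? ?] := jP r.+1 lt_r.
rewrite negb_exists => /forallP mono.
have const r : r < d.+1 -> col (j * d.+1 + r) = col (j * d.+1).
  elim: r => [|r IH] lt_r; first by rewrite addn0.
  rewrite -IH; last exact: ltnW.
  by have := mono (Ordinal (lt_r : r < d)); rewrite negbK addnS => /eqP->.
pose h (r : 'I_d.+1) := Ordinal (lt_block j r (ltn_ord r)).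
have h_inj : injective h by move=> r r' /(congr1 val)/= /addnI/val_inj.
have sub : h @: setT \subset [set m : 'I_N | col m == col (j * d.+1)].
  by apply/subsetP => _ /imsetP[r _ ->]; rewrite !inE /= const.
have := leq_trans (subset_leq_card sub) (few _).
by rewrite card_imset // cardsT card_ord ltnn.
Qed.

(** * The Apollonian network and its straight-line drawing *)

(* A word codes a face of the iterated subdivision of a triangle, the word
   [i :: w] being the face of [w] in which the corner [i] has been replaced by
   the centre of [w]. The same word codes the vertex at the centre of the face.
   The three outermost corners are not vertices. *)
Notation label := (option bool).
Notation word := (seq label).

Fixpoint corner (w : word) (i : label) : option word :=
  if w is j :: w' then if j == i then Some w' else corner w' i else None.

Definition owns (u v : word) : bool := [exists i, corner u i == Some v].

Lemma corner_size w i v : corner w i = Some v -> size v < size w.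
Proof.
by elim: w => //= j w IH; case: eqP => [_ [->] //|_ /IH/ltnW]; rewrite ltnS.
Qed.

Section Drawing.
Local Open Scope R_scope.

Definition centroid (q : label -> R * R) : R * R :=
  ((fst (q None) + fst (q (Some true)) + fst (q (Some false))) / 3,
   (snd (q None) + snd (q (Some true)) + snd (q (Some false))) / 3).

Fixpoint place (w : word) (i : label) : R * R :=
  if w is j :: w' then
    if j == i then centroid (place w') else place w' i
  else match i with None => (0, 0) | Some true => (1, 0) | Some false => (0, 1) end.

Definition centre (w : word) : R * R := centroid (place w).

Lemma place_corner w i v : corner w i = Some v -> place w i = centre v.
Proof. by elim: w => //= j w IH; case: eqP => [_ [<-]|_ /IH]. Qed.

(* Barycentric coordinates with respect to the triangle [place w]. *)
Fixpoint bary (w : word) (i : label) (p : R * R) : R :=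
  if w is j :: w' then
    if j == i then 3 * bary w' j p else bary w' i p - bary w' j p
  else match i with
       | None => 1 - fst p - snd p | Some true => fst p | Some false => snd p end.

Lemma bary_affine w i : exists a b c, forall p, bary w i p = a + b * fst p + c * snd p.
Proof.
elim: w i => [|j w IH] i /=.
  by case: i => [[]|]; [exists 0, 1, 0|exists 0, 0, 1|exists 1, (-1), (-1)]; move=> p; ring.
have [a [b [c Ei]]] := IH i; have [a' [b' [c' Ej]]] := IH j.
case: eqP => _; first by exists (3 * a'), (3 * b'), (3 * c') => p; rewrite Ej; ring.
by exists (a - a'), (b - b'), (c - c') => p; rewrite Ei Ej; ring.
Qed.

Lemma bary_centre_place w i :
  bary w i (centre w) =
  (bary w i (place w None) + bary w i (place w (Some true)) + bary w i (place w (Some false))) / 3.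
Proof. by have [a [b [c E]]] := bary_affine w i; rewrite !E /=; field. Qed.

Lemma bary_place w i k : bary w i (place w k) = if i == k then 1 else 0.
Proof.
elim: w i k => [|j w IH] i k; first by case: i k => [[]|] [[]|] /=; ring.
have bc h : bary w h (centre w) = / 3.
  by rewrite bary_centre_place !IH; case: h => [[]|] /=; field.
rewrite /=; case: (eqVneq j k) => [->|jk]; last first.
  case: (eqVneq j i) => [<-|ji]; first by rewrite IH (negPf jk); ring.
  by rewrite !IH (negPf jk); case: eqP => _; ring.
rewrite -/(centre w) (eq_sym i); case: (eqVneq k i) => _; rewrite !bc; field.
Qed.

Lemma bary_centre w i : bary w i (centre w) = / 3.
Proof. by rewrite bary_centre_place !bary_place; case: i => [[]|] /=; field. Qed.

Definition segment (p q : R * R) (t : R) : R * R :=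
  ((1 - t) * fst p + t * fst q, (1 - t) * snd p + t * snd q).

(* The barycentric form of [p = segment (centre w) (place w i) t]. *)
Definition on_spoke w i t p : Prop :=
  forall j, bary w j p = (1 - t) / 3 + (if j == i then t else 0).

Lemma on_spoke_segment w i v t :
  corner w i = Some v -> on_spoke w i t (segment (centre w) (centre v) t).
Proof.
move=> wv k; have [a [b [c E]]] := bary_affine w k.
have -> : bary w k (segment (centre w) (centre v) t) =
    (1 - t) * bary w k (centre w) + t * bary w k (centre v) by rewrite !E /=; ring.
by rewrite bary_centre -(place_corner wv) bary_place; case: eqP => _; field.
Qed.

Lemma on_spoke_centre w i : on_spoke w i 0 (centre w).
Proof. by move=> j; rewrite bary_centre; case: eqP => _; field. Qed.

Lemma bary_cat_pos s w p : (forall i, 0 < bary (s ++ w) i p) -> forall i, 0 < bary w i p.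
Proof.
elim: s => //= j s IH pos; apply: IH => i.
have pj := pos j; have pi := pos i; rewrite eqxx in pj.
by case: eqP pi => [<-|_]; lra.
Qed.

Lemma bary_cons_lt j w p : (forall i, 0 < bary (j :: w) i p) ->
  forall i, i != j -> bary w j p < bary w i p.
Proof. by move=> pos i ij; have := pos i; rewrite /= eq_sym (negPf ij); lra. Qed.

(* A point inside the face [j :: w] has its least [w]-coordinate at [j] only,
   whereas on a spoke of [w] the least coordinate is attained twice. *)
Lemma on_spoke_not_deeper w i t p s j : 0 <= t < 1 -> on_spoke w i t p ->
  ~ forall k, 0 < bary (s ++ j :: w) k p.
Proof.
move=> t01 spk /bary_cat_pos/bary_cons_lt lt_j.
have [k [kj ki]] : exists k, k != j /\ (k != i \/ j = i).
  by case: i j {spk lt_j} => [[]|] [[]|]; do ?[by exists None; auto | by exists (Some true); auto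
    | by exists (Some false); auto].
have := lt_j k kj; rewrite !spk; case: ki => [/negPf->|->]; last first.
  by rewrite eqxx; case: eqP => _; lra.
by case: eqP => _; lra.
Qed.

(** Distinct children [j], [j'] of a face have disjoint interiors: the least coordinate would be
    attained only at [j] and only at [j']. *)
Lemma bary_pos_comparable w w' p :
  (forall i, 0 < bary w i p) -> (forall i, 0 < bary w' i p) ->
  [\/ w = w', exists s j, w' = s ++ j :: w | exists s j, w = s ++ j :: w'].
Proof.
elim: w => [|j w IH].
  move=> _ _; case/lastP: w' => [|s j]; first by constructor 1.
  by constructor 2; exists s, j; rewrite cats1.
move=> pos pos'; have [ww'|[s [j' ew']]|[s [j' ew]]] := IH (@bary_cat_pos [:: j] _ _ pos) pos'.
- by constructor 3; exists [::], j; rewrite ww'.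
- have [<-|jj'] := eqVneq j' j.
    case/lastP: s ew' => [|s k] ->; first by constructor 1.
    by constructor 2; exists s, k; rewrite cat_rcons.
  move: pos'; rewrite ew' => /bary_cat_pos/bary_cons_lt lt'.
  by have := bary_cons_lt pos jj'; have := lt' j; rewrite eq_sym => /(_ jj'); lra.
- by constructor 3; exists (j :: s), j'; rewrite ew.
Qed.

(** Both faces contain [p] in their interior, hence are nested, and [on_spoke_not_deeper] makes them
    equal; the coordinates then give the rest. *)
Lemma on_spoke_inj w i t w' i' t' p : 0 <= t < 1 -> 0 <= t' < 1 ->
  on_spoke w i t p -> on_spoke w' i' t' p ->
  [/\ w = w', t = t' & 0 < t -> i = i'].
Proof.
have pos u h r : 0 <= r < 1 -> on_spoke u h r p -> forall k, 0 < bary u k p.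
  by move=> r01 spk k; rewrite spk; case: eqP => _; lra.
move=> t01 t01' spk spk'; have pw := pos _ _ _ t01 spk; have pw' := pos _ _ _ t01' spk'.
have [ww'|[s [j e]]|[s [j e]]] := bary_pos_comparable pw pw'; last 2 first.
- by case: (on_spoke_not_deeper (s := s) (j := j) t01 spk); rewrite -e.
- by case: (on_spoke_not_deeper (s := s) (j := j) t01' spk'); rewrite -e.
subst w'; have := spk i; have := spk' i; have := spk i'; have := spk' i'.
rewrite !eqxx (eq_sym i'); case: eqP => [->|_] e1 e2 e3 e4; split=> //; lra.
Qed.

End Drawing.

Lemma ownsP u v : reflect (exists i, corner u i = Some v) (owns u v).
Proof. by apply: (iffP existsP) => -[i e]; exists i; apply/eqP. Qed.

Lemma owns_corner w i v : corner w i = Some v -> owns w v.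
Proof. by move=> wv; apply/ownsP; exists i. Qed.

Definition touches (u v : word) : bool := owns u v || owns v u.

(** Of two corners, the one inserted last is the centre of a face with the other as a corner. *)
Lemma corners_touch w i j u v : i != j ->
  corner w i = Some u -> corner w j = Some v -> touches u v.
Proof.
elim: w => //= k w IH ij; case: (eqVneq k i) => [ki|_].
  rewrite ki (negPf ij) => -[<-] /owns_corner wv; by rewrite /touches wv.
case: (eqVneq k j) => [_ /owns_corner wu [<-]|_]; last exact: IH.
by rewrite /touches wu orbT.
Qed.

(** * Planarity and richness of the Apollonian network *)

Section Apollonian.
Variable D : nat.

Definition apollonian_rel : rel (D.-bseq label) := fun u v => touches u v.

Lemma apollonian_sym : symmetric apollonian_rel.
Proof. by move=> u v; rewrite /apollonian_rel /touches orbC. Qed.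

Lemma apollonian_irr : irreflexive apollonian_rel.
Proof.
move=> u; rewrite /apollonian_rel /touches orbb; apply/negbTE/negP=> /ownsP[i /corner_size].
by rewrite ltnn.
Qed.

Definition apollonian : sgraph := SGraph apollonian_sym apollonian_irr.

Local Open Scope R_scope.

Lemma apollonian_planar : planar apollonian.
Proof.
pose p (u : apollonian) := centre (val u).
exists p, (fun u v => segment (p u) (p v)).
(* Each edge is a spoke of one of its ends, run through forwards or backwards. *)
have spoke u v : sadj apollonian u v -> exists w i (w' : word),
    corner w i = Some w' /\
    ((val u = w /\ val v = w' /\ forall t, on_spoke w i t (segment (p u) (p v) t)) \/
     (val v = w /\ val u = w' /\ forall t, on_spoke w i (1 - t) (segment (p u) (p v) t))).
  case/orP=> /ownsP[i e].
    exists (val u), i, (val v); split=> //; left; split=> //; split=> // t.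
    exact: on_spoke_segment.
  exists (val v), i, (val u); split=> //; right; split=> //; split=> // t.
  suff -> : segment (p u) (p v) t = segment (p v) (p u) (1 - t) by exact: on_spoke_segment.
  by rewrite /segment; congr pair; ring.
have spoke_open u v t : sadj apollonian u v -> (0 < t < 1) ->
    exists w i (w' : word) t', [/\ corner w i = Some w', (0 < t' < 1),
      on_spoke w i t' (segment (p u) (p v) t) &
      (val u = w /\ val v = w') \/ (val v = w /\ val u = w')].
  move=> uv t01; have [w [i [w' [e [[eu [ev spk]]|[ev [eu spk]]]]]]] := spoke u v uv.
    by exists w, i, w', t; split; auto.
  by exists w, i, w', (1 - t); split; auto; lra.
have t0 : 0 <= 0 < 1 by lra.
have open_le r : 0 < r < 1 -> 0 <= r < 1 by lra.
split.
  move=> u v e; apply: val_inj.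
  (* A centre has parameter 0 on each of its spokes; the label [None] is arbitrary. *)
  have spk_v : on_spoke (val v) None 0 (p u) by rewrite e; apply: on_spoke_centre.
  by have [] := on_spoke_inj t0 t0 (on_spoke_centre (val u) None) spk_v.
move=> u v uv; split.
- by split; rewrite /segment /=; reg.
- by rewrite /segment /p; split; apply: injective_projections => /=; ring.
- move=> s t s01 t01; have [w [i [w' [_ [[_ [_ spk]]|[_ [_ spk]]]]]]] := spoke u v uv.
    by move=> e; have := spk s i; rewrite e spk eqxx; lra.
  by move=> e; have := spk s i; rewrite e spk eqxx; lra.
- move=> t x t01 e; have [w [i [w' [t' [_ t01' spk _]]]]] := spoke_open u v t uv t01.
  have spk_x : on_spoke (val x) None 0 (segment (p u) (p v) t).
    by rewrite e; apply: on_spoke_centre.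
  by have [_ t'0 _] := on_spoke_inj (open_le _ t01') t0 spk spk_x; lra.
- move=> u' v' uv' ne s t s01 t01 e.
  have [w1 [i1 [w1' [s' [e1 s01' spk1 own1]]]]] := spoke_open u v s uv s01.
  have [w2 [i2 [w2' [t' [e2 t01' spk2 own2]]]]] := spoke_open u' v' t uv' t01.
  rewrite -e in spk2.
  have [ew _ ei] := on_spoke_inj (open_le _ s01') (open_le _ t01') spk1 spk2.
  have {}ei : i1 = i2 by apply: ei; lra.
  have ew' : w1' = w2' by apply: Some_inj; rewrite -e1 -e2 ew ei.
  apply: ne; subst w2 i2 w2'.
  by case: own1 own2 => [[? ?]|[? ?]] [[? ?]|[? ?]]; [left|right|right|left];
    split; apply: val_inj; congruence.
Qed.

Local Close Scope R_scope.

(* The path through the common neighbourhood of the corners [i] and [j] of a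
   face consists of the centres reached by repeatedly replacing the corner [k]. *)
Lemma face_rich N k (w : word) i j (u v : apollonian) :
  i != j -> corner w i = Some (val u) -> corner w j = Some (val v) ->
  size w + k * N.+1 <= D -> rich N k u v.
Proof.
elim: k w i j u v => [|k IH] w i j u v ij wu wv le_wD.
  exact: corners_touch wu wv.
split; first by apply: IH ij wu wv _; lia.
have [h [hi hj]] : exists h : label, h != i /\ h != j.
  by case: i j {wu wv ij} => [[]|] [[]|]; do ?[by exists None | by exists (Some true)
    | by exists (Some false)].
pose q m := nseq m h ++ w.
have qu m : corner (q m) i = Some (val u).
  by elim: m => //= m ->; rewrite (negPf hi).
have qv m : corner (q m) j = Some (val v).
  by elim: m => //= m ->; rewrite (negPf hj).
have szq m : m <= N -> size (q m) + k * N.+1 < D.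
  by move=> le_m; rewrite size_cat size_nseq; rewrite mulSn in le_wD; lia.
(* The default value of [insub_bseq] is never taken for [m < N]. *)
exists (fun m => insub_bseq D (q m)).
have qE m : m < N -> val (insub_bseq D (q m) : apollonian) = q m.
  move=> lt_m; rewrite /insub_bseq val_insubd ifT //.
  exact: leq_trans (leq_addr _ _) (ltnW (szq m (ltnW lt_m))).
split.
- move=> m m' lt_m lt_m' /(congr1 (fun u : apollonian => size (val u))).
  by rewrite !qE // !size_cat !size_nseq => /addIn.
- move=> m lt_m; split.
    apply: (IH (h :: q m) i h); rewrite /= ?eqxx ?(negPf hi) ?qE //; first by rewrite eq_sym.
    by have := szq m (ltnW lt_m); lia.
  apply: (IH (h :: q m) j h); rewrite /= ?eqxx ?(negPf hj) ?qE //; first by rewrite eq_sym.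
  by have := szq m (ltnW lt_m); lia.
(* This face has [q m] and [q m.+1] as corners [h] and [i], and at most [N.+1] letters more than
   [w]. *)
- move=> m lt_m; apply: (IH (i :: q m.+1) h i); rewrite /= ?eqxx ?(eq_sym i) ?(negPf hi) ?qE //.
    exact: ltnW.
  by have := szq m.+1 (ltnW lt_m); rewrite /=; lia.
Qed.

End Apollonian.

(** * Embeddings of rich edges into the product *)

Section Containment.
Variables (c : nat) (G H T : sgraph) (f : G -> strong (strong H T) (K c)).
Hypotheses (treeT : is_tree T) (twH : tw_le H 2) (f_inj : injective f).
Hypothesis f_adj : forall x y, sadj G x y -> sadj (strong (strong H T) (K c)) (f x) (f y).

Let phi (x : G) : H := (f x).1.1.
Let psi (x : G) : T := (f x).1.2.
(** Bound for a fibre of [phi] on a path lying in two fibres of [psi]; [N] is the matching length in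
    [sparse_colours]. *)
Let d := c.*2.
Let N := (d.*2.+1 * d.+1)%N.

Lemma phi_adj x y : sadj G x y -> phi x != phi y -> sadj H (phi x) (phi y).
Proof.
move/f_adj; rewrite /= /strong_rel /= /phi => /andP[_].
case/or3P=> [/andP[/eqP-> _]|/andP[_]|/andP[+ _]]; first by rewrite eqxx.
  all: rewrite /strong_rel => /andP[_ /or3P[/andP[/eqP-> _]|/andP[_ //]|/andP[//]]].
all: by rewrite eqxx.
Qed.

Lemma psi_adj x y : sadj G x y -> psi x != psi y -> sadj T (psi x) (psi y).
Proof.
move/f_adj; rewrite /= /strong_rel /= /psi => /andP[_].
case/or3P=> [/andP[/eqP-> _]|/andP[_]|/andP[+ _]]; first by rewrite eqxx.
  all: rewrite /strong_rel => /andP[_ /or3P[/andP[_ //]|/andP[/eqP-> _]|/andP[_ //]]].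
all: by rewrite eqxx.
Qed.

(** Within a common fibre, [f] separates vertices by the coordinate in [K c] alone. *)
Lemma fibre_le (p : nat -> G) a t : {in gtn N &, injective p} ->
  #|[set m : 'I_N | (phi (p m) == a) && (psi (p m) == t)]| <= c.
Proof.
move=> p_inj; rewrite -[leqRHS]card_ord; apply: (@leq_card_in _ _ (fun m : 'I_N => (f (p m)).2)).
move=> m m'; rewrite !inE => /andP[/eqP am /eqP tm] /andP[/eqP am' /eqP tm'] e.
apply/val_inj/p_inj; rewrite ?inE ?ltn_ord //; apply: f_inj.
move: am tm am' tm' e; rewrite /phi /psi.
by case: (f (p m)) => [[? ?] ?]; case: (f (p m')) => [[? ?] ?] /= -> -> -> -> ->.
Qed.

Lemma two_fibres_le (p : nat -> G) s t a : {in gtn N &, injective p} ->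
  (forall m, m < N -> psi (p m) = s \/ psi (p m) = t) ->
  #|[set m : 'I_N | phi (p m) == a]| <= d.
Proof.
move=> p_inj st; rewrite /d -addnn.
apply: leq_trans (leq_add (fibre_le a s p_inj) (fibre_le a t p_inj)).
apply: leq_trans (leq_card_setU _ _); apply/subset_leq_card/subsetP => m.
rewrite !inE => /eqP->; rewrite eqxx /=.
by case: (st m (ltn_ord m)) => ->; rewrite eqxx ?orbT.
Qed.

(* Otherwise some edge of the path [p] spans, together with [u] and [v], a K4
   under [phi]. *)
Lemma two_trees_phi_eq u v (p : nat -> G) s t : {in gtn N &, injective p} ->
  sadj G u v ->
  (forall m, m < N -> sadj G u (p m) /\ sadj G v (p m)) ->
  (forall m, m.+1 < N -> sadj G (p m) (p m.+1)) ->
  (forall m, m < N -> psi (p m) = s \/ psi (p m) = t) -> phi u = phi v.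
Proof.
move=> p_inj uv up pp st; apply/eqP/negPn/negP => ne.
have [m [lt_m xy [xu xv yu yv]]] := @sparse_colours H (phi \o p) d N (phi u) (phi v)
  (erefl _) (fun a => two_fibres_le a p_inj st).
have [ux vx] := up m (ltnW lt_m); have [uy vy] := up _ lt_m.
apply: (@tw2_no_K4 H (phi u) (phi v) (phi (p m)) (phi (p m.+1)) twH).
  by rewrite /= !inE !negb_or ne (eq_sym (phi u)) xu (eq_sym (phi u)) yu
    (eq_sym (phi v)) xv (eq_sym (phi v)) yv xy.
rewrite /= !phi_adj // 1?eq_sym //; exact: pp.
Qed.

Lemma psi_common_neighbour u v x : psi u != psi v ->
  sadj G u v -> sadj G u x -> sadj G v x -> psi x = psi u \/ psi x = psi v.
Proof.
move=> ne uv ux vx; have [|xu] := eqVneq (psi x) (psi u); first by left.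
have [|xv] := eqVneq (psi x) (psi v); first by right.
case: (tree_triangle_free treeT (psi_adj uv ne) (a := psi u) (b := psi v) (c := psi x)).
  by apply: psi_adj; rewrite // eq_sym.
by apply: psi_adj; rewrite // sadj_sym.
Qed.

Lemma rich1_eq (u v : G) : rich N 1 u v -> psi u != psi v -> phi u = phi v.
Proof.
move=> /richS[uv [p [p_inj up pp]]] ne.
apply: (two_trees_phi_eq (s := psi u) (t := psi v) p_inj uv up pp) => m lt_m.
by have [? ?] := up m lt_m; apply: psi_common_neighbour.
Qed.

Lemma rich2_phi (u v : G) : rich N 2 u v -> phi u = phi v.
Proof.
move=> /richS[ruv [p [p_inj up pp]]]; have uv := rich_adj ruv.
apply/eqP/negPn/negP => ne.
have psi_uv : psi u = psi v by apply/eqP/negPn/negP => /(rich1_eq ruv)/eqP; apply/negP.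
case/eqP: (ne); apply: (two_trees_phi_eq (s := psi u) (t := psi u) p_inj uv).
- by move=> m /up[/rich_adj ? /rich_adj ?].
- by move=> m /pp/rich_adj.
- move=> m lt_m; left; apply/eqP/negPn/negP => ne'.
  have [/rich1_eq eu /rich1_eq ev] := up m lt_m.
  by case/eqP: (ne); rewrite eu 1?eq_sym // ev // -psi_uv eq_sym.
Qed.

Lemma const_path_absurd (p : nat -> G) a s t : {in gtn N &, injective p} ->
  (forall m, m < N -> phi (p m) = a) ->
  (forall m, m < N -> psi (p m) = s \/ psi (p m) = t) -> False.
Proof.
move=> p_inj pa st; have := two_fibres_le a p_inj st.
rewrite (_ : [set _ | _] = setT); last by apply/setP=> m; rewrite !inE pa ?eqxx.
by rewrite cardsT card_ord /N; nia.
Qed.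

Lemma rich3_psi (u v : G) : rich N 3 u v -> psi u = psi v.
Proof.
move=> /richS[ruv [p [p_inj up _]]]; apply/eqP/negPn/negP => ne.
apply: (@const_path_absurd p (phi u) (psi u) (psi v) p_inj) => m lt_m;
  have [ru rv] := up m lt_m; first by rewrite (rich2_phi ru).
by apply: psi_common_neighbour ne _ _ _; apply: rich_adj; eassumption.
Qed.

Lemma rich4_absurd (u v : G) : ~ rich N 4 u v.
Proof.
move=> /richS[_ [p [p_inj up _]]].
apply: (@const_path_absurd p (phi u) (psi u) (psi u) p_inj) => m lt_m;
  have [ru _] := up m lt_m.
  by rewrite (@rich2_phi u (p m)) //; case: ru.
by left; rewrite (rich3_psi ru).
Qed.

End Containment.

Theorem theorem1p3 (c : nat) : 1 <= c ->
  exists G : sgraph, planar G /\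
    forall T H : sgraph, is_tree T -> tw_le H 2 ->
      ~ contained G (strong (strong H T) (K c)).
Proof.
(* The starting face has two letters, and each of the four levels of richness costs [N.+1] more. *)
move=> _; set N := (c.*2.*2.+1 * c.*2.+1)%N; set D := 2 + 4 * N.+1.
exists (apollonian D); split; first exact: apollonian_planar.
move=> T H treeT twH [f [f_inj f_adj]].
pose u : apollonian D := Bseq (isT : size [::] <= D).
pose v : apollonian D := Bseq (isT : size [:: None] <= D).
have uv : rich N 4 u v by apply: (@face_rich D N 4 [:: Some true; None] None (Some true)).
exact (rich4_absurd treeT twH f_inj f_adj uv).
Qed.
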